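(* Let $p\ge 1$, $L\ge 2$ be integers and $\lambda_1,\lambda_2\ge 0$. Let $\mathcal{Y}=\mathbb{S}^p\times\cdots\times\mathbb{S}^p$ ($L$ copies), let $\mathcal{P}$ be the fused graphical Lasso regularizer on $\mathcal{Y}$, $$\mathcal{P}(\Theta)=\lambda_1\sum_{l=1}^L\sum_{i\ne j}|\Theta^{(l)}_{ij}|+\lambda_2\sum_{l=2}^L\sum_{i\neq j}|\Theta^{(l)}_{ij}-\Theta^{(l-1)}_{ij}|,$$ and let $\widehat{\partial}\mathrm{Prox}_{\mathcal{P}}$ be its surrogate generalized Jacobian multifunction, as defined in the context. Then: (1) $X\mapsto\widehat{\partial}\mathrm{Prox}_{\mathcal{P}}(X)$ is a nonempty compact valued, upper semicontinuous multifunction on $\mathcal{Y}$. (2) For every $X\in\mathcal{Y}$, every element of $\widehat{\partial}\mathrm{Prox}_{\mathcal{P}}(X)$ is a self-adjoint positive semidefinite linear operator on $\mathcal{Y}$. (3) For every $X\in\mathcal{Y}$ there exists a neighborhood $\mathcal{U}_X$ of $X$ such that for all $Y\in\mathcal{U}_X$, $$\mathrm{Prox}_{\mathcal{P}}(Y)-\mathrm{Prox}_{\mathcal{P}}(X)-\mathcal{W}[Y-X]=0\qquad\forall\,\mathcal{W}\in\widehat{\partial}\mathrm{Prox}_{\mathcal{P}}(Y).$$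
   Context: $\mathbb{S}^p$ is the space of real symmetric $p\times p$ matrices; $\mathbb{S}^L_+$ is the set of symmetric positive semidefinite $L\times L$ matrices. $\mathcal{Y}=\mathbb{S}^p\times\cdots\times\mathbb{S}^p$ ($L$ copies) carries the product of trace (Frobenius) inner products. For $X=(X^{(1)},\dots,X^{(L)})\in\mathcal{Y}$, $X_{[ij]}:=[X^{(1)}_{ij};\dots;X^{(L)}_{ij}]\in\mathbb{R}^L$. For a proper closed convex function $g$ on a finite-dimensional real Hilbert space, $\mathrm{Prox}_g(u)=\arg\min_{u'}\{g(u')+\frac12\|u'-u\|^2\}$. Fused Lasso regularizer: $\varphi(x)=\lambda_1\|x\|_1+\lambda_2\|Bx\|_1$ for $x\in\mathbb{R}^L$, where $B\in\mathbb{R}^{(L-1)\times L}$ is given by $Bx=[x_1-x_2;\dots;x_{L-1}-x_L]$. Thus $\mathcal{P}(\Theta)=\sum_{i\ne j}\varphi(\Theta_{[ij]})$. Surrogate generalized Jacobian of $\mathrm{Prox}_\varphi$ at $v\in\mathbb{R}^L$: let $x_{\lambda_2}(v)=\arg\min_x\{\lambda_2\|Bx\|_1+\frac12\|x-v\|^2\}$ and, for $u\in\mathbb{R}^{L-1}$, $z_{\lambda_2}(u)=\arg\min_z\{\frac12\|B^Tz\|^2-\langle z,u\rangle : \|z\|_\infty\le\lambda_2\}$. Let $\mathcal{I}_z(v)=\{i\in\{1,\dots,L-1\}: |(z_{\lambda_2}(Bv))_i|=\lambda_2\}$ and $\mathcal{K}_z(v)=\{K\subseteq\{1,\dots,L-1\}: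 \mathrm{supp}(Bx_{\lambda_2}(v))\subseteq K\subseteq\mathcal{I}_z(v)\}$, where $\mathrm{supp}$ denotes the set of indices of nonzero entries. For $K\subseteq\{1,\dots,L-1\}$ let $\Sigma_K\in\mathbb{R}^{(L-1)\times(L-1)}$ be the diagonal matrix with $i$-th diagonal entry $0$ if $i\in K$ and $1$ if $i\notin K$. With $\dagger$ the Moore–Penrose pseudoinverse, set $\mathcal{Q}_z(v)=\{(\Sigma_KBB^T\Sigma_K)^\dagger: K\in\mathcal{K}_z(v)\}$ and $\mathcal{Q}_x(v)=\{I-B^T\widehat{Q}B:\widehat{Q}\in\mathcal{Q}_z(v)\}$. Then $$\widehat{\partial}\mathrm{Prox}_\varphi(v)=\{M\in\mathbb{S}^L_+: M=\Upsilon Q,\ \Upsilon\in\partial_B\mathrm{Prox}_{\lambda_1\|\cdot\|_1}(x_{\lambda_2}(v)),\ Q\in\mathcal{Q}_x(v)\},$$ where $\partial_B F(x)$ (the B-subdifferential of a locally Lipschitz map $F$) is the set of all limits of Jacobians $F'(x^k)$ along sequences $x^k\to x$ of points at which $F$ is differentiable. Surrogate generalized Jacobian of $\mathrm{Prox}_{\mathcal{P}}$ at $X\in\mathcal{Y}$: a linear operator $\mathcal{W}:\mathcal{Y}\to\mathcal{Y}$ belongs to $\widehat{\partial}\mathrm{Prox}_{\mathcal{P}}(X)$ if and only if there exist $M^{(ij)}\in\widehat{\partial}\mathrm{Prox}_\varphi(X_{[ij]})$ for $1\le i<j\le p$ such that for all $Y\in\mathcal{Y}$ and all $i,j\in\{1,\dots,p\}$: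 $(\mathcal{W}[Y])_{[ij]}=M^{(ij)}Y_{[ij]}$ if $i<j$, $(\mathcal{W}[Y])_{[ii]}=Y_{[ii]}$ if $i=j$, and $(\mathcal{W}[Y])_{[ij]}=M^{(ji)}Y_{[ij]}$ if $j<i$. *)

(* Defs.v *)
From HB Require Import structures.
From mathcomp Require Import all_boot all_order all_algebra ring lra.
From mathcomp Require Import all_classical all_reals all_analysis.

Set Implicit Arguments.
Unset Strict Implicit.
Unset Printing Implicit Defensive.

Import Order.TTheory GRing.Theory Num.Theory.
Import numFieldNormedType.Exports.

Local Open Scope classical_set_scope.
Local Open Scope ring_scope.

(* A minimizer of [f] over [D]; the junk value 0 is only returned when there
   is none. For nonnegative weights every problem below is strongly convex on a
   nonempty closed convex set, so that its minimizer exists and is unique. *)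
Definition argmin (R : realType) (T : zmodType) (D : set T) (f : T -> R) : T :=
  xget 0 [set x | D x /\ forall y, D y -> f x <= f y].

(* Proximal mapping of a real-valued [g], relative to the inner product [dot]. *)
Definition prox (R : realType) (T : zmodType) (dot : T -> T -> R) (g : T -> R)
    (u : T) : T :=
  argmin setT (fun x => g x + 2^-1 * dot (x - u) (x - u)).

(* The norm which the library puts on ['cV[R]_n] is the sup norm, hence these. *)
Definition dotv (R : realType) (n : nat) (x y : 'cV[R]_n) : R :=
  \sum_i x i 0 * y i 0.

Definition norm1 (R : realType) (n : nat) (x : 'cV[R]_n) : R :=
  \sum_i (`|x i 0| : R).

Definition psdmx (R : realType) (n : nat) (M : 'M[R]_n) : Prop :=
  M^T = M /\ forall x : 'cV[R]_n, 0 <= dotv x (M *m x).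

(* [Q] is the Moore-Penrose pseudoinverse of [A] (the four Penrose equations,
   which determine [Q] uniquely); [pinvmx] is a different partial inverse. *)
Definition is_mpinv (R : realType) (m n : nat) (A : 'M[R]_(m, n))
    (Q : 'M[R]_(n, m)) : Prop :=
  [/\ A *m Q *m A = A, Q *m A *m Q = Q,
      (A *m Q)^T = A *m Q & (Q *m A)^T = Q *m A].

(* The library's [jacobian] is for row vectors and is transposed. *)
Definition jacobmx (R : realType) (m n : nat) (F : 'cV[R]_n -> 'cV[R]_m)
    (x : 'cV[R]_n) : 'M[R]_(m, n) :=
  \matrix_(i, j) ('d F x (delta_mx j 0) : 'cV[R]_m) i 0.

Definition Bsubdiff (R : realType) (m n : nat) (F : 'cV[R]_n -> 'cV[R]_m)
    (x : 'cV[R]_n) : set 'M[R]_(m, n) :=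
  [set J | exists u : nat -> 'cV[R]_n,
    [/\ forall k, differentiable F (u k),
        u @ \oo --> x &
        (fun k => jacobmx F (u k)) @ \oo --> J]].

Definition upper_semicontinuous (T U : topologicalType) (F : T -> set U) : Prop :=
  forall x (V : set U), open V -> F x `<=` V -> \forall y \near x, F y `<=` V.

Section FusedLasso.
Variables (R : realType) (L : nat).

Definition Bmx : 'M[R]_(L.-1, L) :=
  \matrix_(i, j) ((j == i :> nat)%:R - (j == i.+1 :> nat)%:R).

Definition x_fused (lam2 : R) (v : 'cV[R]_L) : 'cV[R]_L :=
  prox (@dotv R L) (fun x => lam2 * norm1 (Bmx *m x)) v.

Definition z_fused (lam2 : R) (u : 'cV[R]_(L.-1)) : 'cV[R]_(L.-1) :=
  argmin [set z : 'cV[R]_(L.-1) | forall i, `|z i 0| <= lam2]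
    (fun z => 2^-1 * dotv (Bmx^T *m z) (Bmx^T *m z) - dotv z u).

Definition supp (n : nat) (x : 'cV[R]_n) : {set 'I_n} :=
  [set i | x i 0 != 0]%SET.

Definition Iz (lam2 : R) (v : 'cV[R]_L) : {set 'I_L.-1} :=
  [set i | `|z_fused lam2 (Bmx *m v) i 0| == lam2]%SET.

Definition Kz (lam2 : R) (v : 'cV[R]_L) : set {set 'I_L.-1} :=
  [set K : {set 'I_L.-1} | (supp (Bmx *m x_fused lam2 v) \subset K) && (K \subset Iz lam2 v)].

Definition Sigmamx (K : {set 'I_L.-1}) : 'M[R]_(L.-1) :=
  diag_mx (\row_i (i \notin K)%:R).

Definition Qz (lam2 : R) (v : 'cV[R]_L) : set 'M[R]_(L.-1) :=
  [set Q | exists2 K, Kz lam2 v K &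
    is_mpinv (Sigmamx K *m Bmx *m Bmx^T *m Sigmamx K) Q].

Definition Qx (lam2 : R) (v : 'cV[R]_L) : set 'M[R]_L :=
  [set 1%:M - Bmx^T *m Q *m Bmx | Q in Qz lam2 v].

Definition dprox_phi (lam1 lam2 : R) (v : 'cV[R]_L) : set 'M[R]_L :=
  [set M | psdmx M /\ exists U Q,
    [/\ Bsubdiff (prox (@dotv R L) (fun x => lam1 * norm1 x))
          (x_fused lam2 v) U,
        Qx lam2 v Q & M = U *m Q]].

End FusedLasso.

(* L-tuples of symmetric p x p matrices: the symmetric matrices are the fixed
   points of transposition. *)
Definition symfam (R : realType) (L p : nat) : Type :=
  {ffun 'I_L -> subvs_of (fixedSpace (linfun (@trmx R p p)))}.

HB.instance Definition _ (R : realType) (L p : nat) :=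
  Vector.on (symfam R L p).

Section SymFam.
Variables (R : realType) (L p : nat).
Notation Y := (symfam R L p).
Implicit Types X Z : Y.

Definition slice X (l : 'I_L) : 'M[R]_p := vsval (X l).

Lemma slice_sym X l : (slice X l)^T = slice X l.
Proof.
by rewrite /slice; have /fixedSpaceP := subvsP (X l); rewrite lfunE.
Qed.

Lemma sliceP (A : 'I_L -> 'M[R]_p) : (forall l, (A l)^T = A l) ->
  exists X, slice X =1 A.
Proof.
move=> symA; exists [ffun l => vsproj _ (A l)] => l.
by rewrite /slice ffunE vsprojK//; apply/fixedSpaceP; rewrite lfunE /= symA.
Qed.

Definition fiber X (i j : 'I_p) : 'cV[R]_L := \col_l slice X l i j.

Definition dotY X Z : R := \sum_l \tr ((slice X l)^T *m slice Z l).

Definition normY X : R := Num.sqrt (dotY X X).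

Lemma dotYE X Z : dotY X Z = \sum_l \sum_i \sum_j slice X l j i * slice Z l j i.
Proof.
apply: eq_bigr => l _; apply: eq_bigr => i _; rewrite mxE.
by apply: eq_bigr => j _; rewrite mxE.
Qed.

Lemma sliceD X Z l : slice (X + Z) l = slice X l + slice Z l.
Proof. by rewrite /slice ffunE linearD. Qed.

Lemma sliceZ a X l : slice (a *: X) l = a *: slice X l.
Proof. by rewrite /slice ffunE linearZ. Qed.

Lemma dotYC X Z : dotY X Z = dotY Z X.
Proof.
rewrite !dotYE; do 3! apply: eq_bigr => ? _; exact: mulrC.
Qed.

Lemma dotYDl X X' Z : dotY (X + X') Z = dotY X Z + dotY X' Z.
Proof.
rewrite /dotY -big_split; apply: eq_bigr => l _.
by rewrite sliceD linearD /= mulmxDl mxtraceD.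
Qed.

Lemma dotYZl a X Z : dotY (a *: X) Z = a * dotY X Z.
Proof.
rewrite /dotY mulr_sumr; apply: eq_bigr => l _.
by rewrite sliceZ linearZ /= -scalemxAl mxtraceZ.
Qed.

Lemma dotYDr X Z Z' : dotY X (Z + Z') = dotY X Z + dotY X Z'.
Proof. by rewrite dotYC dotYDl !(dotYC _ X). Qed.

Lemma dotYZr a X Z : dotY X (a *: Z) = a * dotY X Z.
Proof. by rewrite dotYC dotYZl dotYC. Qed.

Lemma dotY_ge0 X : 0 <= dotY X X.
Proof.
by rewrite dotYE; do 3! apply: sumr_ge0 => ? _; rewrite -expr2 sqr_ge0.
Qed.

Lemma dotY_eq0 X : dotY X X = 0 -> X = 0.
Proof.
rewrite dotYE => /eqP; rewrite psumr_eq0; last first.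
  by move=> l _; do 2! apply: sumr_ge0 => ? _; rewrite -expr2 sqr_ge0.
move=> /allP X0; apply/ffunP => l; apply/val_inj/matrixP => i j.
have := X0 l (mem_index_enum _); rewrite psumr_eq0 /=; last first.
  by move=> *; apply: sumr_ge0 => ? _; rewrite -expr2 sqr_ge0.
move=> /allP /(_ j (mem_index_enum _)); rewrite psumr_eq0 /=; last first.
  by move=> *; rewrite -expr2 sqr_ge0.
move=> /allP /(_ i (mem_index_enum _)) /=; rewrite mulf_eq0 orbb => /eqP.
by rewrite /slice ffunE linear0 mxE.
Qed.

Lemma dotY_CS X Z : dotY X Z ^+ 2 <= dotY X X * dotY Z Z.
Proof.
have [Z0|] := eqVneq (dotY Z Z) 0.
  rewrite (dotY_eq0 Z0) dotYC -(scale0r 0) !dotYZl !mul0r expr0n /=.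
  by rewrite mulr0.
set b := dotY X Z; set c := dotY Z Z => c0.
have cgt0 : 0 < c by rewrite lt_def c0 dotY_ge0.
have := dotY_ge0 (c *: X + - b *: Z).
rewrite !(dotYDl, dotYZl, dotYDr, dotYZr) (dotYC Z X) -/b -/c => h.
have : 0 <= c * (dotY X X * c - b ^+ 2).
  by apply: le_trans h _; rewrite le_eqVlt; apply/orP; left; apply/eqP; ring.
by rewrite pmulr_rge0// subr_ge0.
Qed.

Lemma normY_triangle X Z : normY (X + Z) <= normY X + normY Z.
Proof.
rewrite -ler_sqr ?nnegrE ?addr_ge0 ?sqrtr_ge0//.
rewrite sqrrD !sqr_sqrtr ?dotY_ge0// !(dotYDl, dotYDr) (dotYC Z X).
have : dotY X Z <= normY X * normY Z.
  rewrite -sqrtrM ?dotY_ge0// (le_trans (ler_norm _))// -sqrtr_sqr.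
  by rewrite ler_sqrt ?dotY_CS// mulr_ge0 ?dotY_ge0.
by lra.
Qed.

Lemma normYZ a X : normY (a *: X) = `|a| * normY X.
Proof.
by rewrite /normY dotYZl dotYZr mulrA -expr2 sqrtrM ?sqr_ge0// sqrtr_sqr.
Qed.

Lemma normY_eq0 X : normY X = 0 -> X = 0.
Proof.
move=> /eqP; rewrite sqrtr_eq0 => X0; apply/dotY_eq0/eqP.
by rewrite eq_le X0 dotY_ge0.
Qed.

HB.instance Definition _ := @Lmodule_isNormed.Build R Y
  normY normY_triangle normYZ normY_eq0.

Definition symop : Type := 'End(Y).

HB.instance Definition _ := Vector.on symop.

(* The operator-norm topology: uniform convergence on the closed unit ball. *)
HB.instance Definition _ := Topological.copy symop
  (initial_topology (fun W : symop =>
    (fun_of_lfun W : {uniform` [set X : Y | `|X| <= 1] -> Y}))).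

Definition fused_glasso (lam1 lam2 : R) (T : Y) : R :=
  lam1 * (\sum_(l < L) \sum_(i < p) \sum_(j < p | i != j) (`|slice T l i j| : R))
  + lam2 * (\sum_(k < L) \sum_(l < L | l == k.+1 :> nat)
      \sum_(i < p) \sum_(j < p | i != j) (`|slice T l i j - slice T k i j| : R)).

Definition prox_glasso (lam1 lam2 : R) : Y -> Y :=
  prox dotY (fused_glasso lam1 lam2).

Definition dprox_glasso (lam1 lam2 : R) (X : Y) : set symop :=
  [set W : symop | exists M : 'I_p -> 'I_p -> 'M[R]_L,
    (forall i j : 'I_p, (i < j)%N -> dprox_phi lam1 lam2 (fiber X i j) (M i j))
    /\ forall (Z : Y) (i j : 'I_p), fiber (W Z) i j =
         if (i < j)%N then M i j *m fiber Z i j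
         else if (j < i)%N then M j i *m fiber Z i j
         else fiber Z i j].

End SymFam.

(* Main.v *)
Require Import Defs.
From HB Require Import structures.
From mathcomp Require Import all_boot all_order all_algebra ring lra.
From mathcomp Require Import all_classical all_reals all_analysis.

(* Everything is piecewise linear with finitely many pieces. Fiber by fiber, the
   proximal mapping is soft thresholding composed with the fused prox
   x(v) = v - B^T z(v), where z(v) solves the dual box problem; both x and z are
   continuous. Near v, an index set K admissible at w is admissible at v, the
   dual solutions z(w) and z(v) agree on K and the jumps of x(w) and x(v) vanish
   off K, so that x(w) - x(v) is the projection onto {y : (B y)_i = 0 off K} of
   w - v. Likewise the B-subdifferential of soft thresholding consists of 0-1
   diagonal matrices, is locally decreasing, and reproduces increments exactly.
   Hence the surrogate Jacobian is finite valued and locally decreasing, which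
   gives compactness, upper semicontinuity and the exact expansion at once. *)

Set Implicit Arguments.
Unset Strict Implicit.
Unset Printing Implicit Defensive.

Import Order.TTheory GRing.Theory Num.Theory.
Import numFieldNormedType.Exports.

Local Open Scope classical_set_scope.
Local Open Scope ring_scope.

(** * Proximal points from subgradients, and the Euclidean inner product *)

(** Expanding the square around [s] shows that the objective at [y] exceeds the one at [s] by at
    least half of [dot (y - s) (y - s)]. This gives uniqueness as well, so [xget] can only return
    [s]. *)
Lemma prox_subgradient (R : realType) (T : zmodType) (dot : T -> T -> R)
    (g : T -> R) (u s : T) :
  (forall x y, dot x y = dot y x) ->
  (forall x y z, dot (x - y) z = dot x z - dot y z) ->
  (forall x, 0 <= dot x x) -> (forall x, dot x x = 0 -> x = 0) ->
  (forall y, g s + dot (y - s) (u - s) <= g y) -> prox dot g u = s.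
Proof.
move=> dotC dotB dot_ge0 dot_eq0 gs.
have dist2 y : dot (y - u) (y - u) =
    dot (y - s) (y - s) - 2 * dot (y - s) (u - s) + dot (u - s) (u - s).
  have -> : y - u = (y - s) - (u - s) by rewrite opprB addrA subrK.
  move: (y - s) (u - s) => a b.
  by rewrite dotB !(dotC _ (a - b)) !dotB (dotC b a); ring.
have dist_s : dot (s - u) (s - u) = dot (u - s) (u - s).
  have dot0 z : dot 0 z = 0 by rewrite -(subrr 0) dotB subrr.
  by rewrite dist2 subrr !dot0; ring.
apply: xget_unique => [|x [_ /(_ s I)]].
  split=> // y _; rewrite dist_s dist2.
  by have := gs y; have := dot_ge0 (y - s); lra.
rewrite dist_s dist2 => xs; apply/eqP; rewrite -subr_eq0; apply/eqP/dot_eq0.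
by have := gs x; have := dot_ge0 (x - s); lra.
Qed.

Section Dotv.
Variable R : realType.
Implicit Types (n : nat).

Lemma dotvE n (x y : 'cV[R]_n) : dotv x y = (x^T *m y) 0 0.
Proof. by rewrite mxE; apply: eq_bigr => i _; rewrite mxE. Qed.

Lemma dotvC n (x y : 'cV[R]_n) : dotv x y = dotv y x.
Proof. by apply: eq_bigr => i _; rewrite mulrC. Qed.

Lemma dotvDl n (x y z : 'cV[R]_n) : dotv (x + y) z = dotv x z + dotv y z.
Proof. by rewrite -big_split; apply: eq_bigr => i _; rewrite !mxE mulrDl. Qed.

Lemma dotvZl n (a : R) (x z : 'cV[R]_n) : dotv (a *: x) z = a * dotv x z.
Proof. by rewrite mulr_sumr; apply: eq_bigr => i _; rewrite !mxE mulrA. Qed.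

Lemma dotvBl n (x y z : 'cV[R]_n) : dotv (x - y) z = dotv x z - dotv y z.
Proof. by rewrite -scaleN1r dotvDl dotvZl mulN1r. Qed.

Lemma dotvDr n (x y z : 'cV[R]_n) : dotv z (x + y) = dotv z x + dotv z y.
Proof. by rewrite !(dotvC z) dotvDl. Qed.

Lemma dotvZr n (a : R) (x z : 'cV[R]_n) : dotv z (a *: x) = a * dotv z x.
Proof. by rewrite !(dotvC z) dotvZl. Qed.

Lemma dotv0l n (z : 'cV[R]_n) : dotv 0 z = 0.
Proof. by rewrite -(scale0r 0) dotvZl mul0r. Qed.

Lemma dotvBr n (x y z : 'cV[R]_n) : dotv z (x - y) = dotv z x - dotv z y.
Proof. by rewrite !(dotvC z) dotvBl. Qed.

Lemma dotv_ge0 n (x : 'cV[R]_n) : 0 <= dotv x x.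
Proof. by apply: sumr_ge0 => i _; rewrite -expr2 sqr_ge0. Qed.

Lemma dotv_coord n (x : 'cV[R]_n) i : x i 0 ^+ 2 <= dotv x x.
Proof.
rewrite /dotv (bigD1 i)//= -expr2 lerDl.
by apply: sumr_ge0 => j _; rewrite -expr2 sqr_ge0.
Qed.

Lemma dotv_eq0 n (x : 'cV[R]_n) : dotv x x = 0 -> x = 0.
Proof.
move=> x0; apply/matrixP => i j; rewrite !mxE ord1; apply/eqP.
by rewrite -sqrf_eq0 eq_le sqr_ge0 andbT -x0 dotv_coord.
Qed.

Lemma dotv_mul m n (A : 'M[R]_(m, n)) (x : 'cV[R]_n) (y : 'cV[R]_m) :
  dotv (A *m x) y = dotv x (A^T *m y).
Proof. by rewrite !dotvE trmx_mul mulmxA. Qed.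

End Dotv.

(** * Soft thresholding *)

Section SoftThresholding.
Variable R : realType.
Implicit Types (lam a b : R) (n : nat).

Definition soft1 lam a : R :=
  if lam < a then a - lam else if a < - lam then a + lam else 0.

Definition soft lam n (x : 'cV[R]_n) : 'cV[R]_n := \col_i soft1 lam (x i 0).

Lemma soft1_subgradient lam a b : 0 <= lam ->
  lam * `|soft1 lam a| + (b - soft1 lam a) * (a - soft1 lam a) <= lam * `|b|.
Proof.
move=> lam0; rewrite /soft1.
have bp : 0 <= lam * (`|b| - b) by rewrite mulr_ge0// subr_ge0 ler_norm.
have bm : 0 <= lam * (`|b| + b).
  by rewrite mulr_ge0// -[b in _ + b]opprK subr_ge0 -normrN ler_norm.
case: ltP => [la|al]; first by rewrite gtr0_norm ?subr_gt0//; nra.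
case: ltP => [la|la].
  rewrite ltr0_norm; last by lra.
  by nra.
rewrite normr0 !subr0 mulr0 add0r (le_trans (ler_norm _))// normrM mulrC.
by rewrite ler_wpM2r// ler_norml la.
Qed.

Lemma soft1_mono lam a b : 0 <= lam -> a <= b -> soft1 lam a <= soft1 lam b.
Proof. by rewrite /soft1 => l0 ab; do ![case: ltP => ?]; lra. Qed.

(* [d] is a limit of derivatives of [soft1 lam] at points tending to [a]. *)
Definition soft1_slope lam a (d : bool) : bool :=
  if d then lam <= `|a| else (0 < lam) && (`|a| <= lam).

Lemma soft1_0 a : soft1 0 a = a.
Proof. by rewrite /soft1 oppr0; do ![case: ltP => ?]; lra. Qed.

Lemma soft1_pos lam a : 0 <= lam -> lam <= a -> soft1 lam a = a - lam.
Proof. by move=> l0 la; rewrite /soft1; do ![case: ltP => ?]; lra. Qed.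

Lemma soft1_neg lam a : 0 <= lam -> a <= - lam -> soft1 lam a = a + lam.
Proof. by move=> l0 la; rewrite /soft1; do ![case: ltP => ?]; lra. Qed.

Lemma soft1_mid lam a : - lam <= a <= lam -> soft1 lam a = 0.
Proof. by move=> /andP[? ?]; rewrite /soft1; do ![case: ltP => ?]; lra. Qed.

(** For [b] close to [a], a slope admissible at [b] belongs to a linear piece whose closure contains
    both points; so it is admissible at [a] and yields the exact increment. *)
Lemma soft1_affine lam a : 0 <= lam -> \forall b \near a, forall d,
  soft1_slope lam b d ->
  soft1_slope lam a d /\ soft1 lam b - soft1 lam a = d%:R * (b - a).
Proof.
rewrite le_eqVlt => /predU1P[<-|lam0].
  (* For [lam = 0] slope 0 is never admissible and [soft1] is the identity. *)
  near=> b => -[] /=; rewrite ?ltxx// normr_ge0 !soft1_0 => _; split=> //.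
  by rewrite mul1r.
rewrite /soft1_slope lam0 /=.
(* It suffices to argue on one open interval around [a], chosen by the position of [a] relative to
   the two kinks. *)
have step (lo hi : R) : lo < a < hi -> (forall b d, lo < b < hi ->
    (if d then lam <= `|b| else `|b| <= lam) ->
    (if d then lam <= `|a| else `|a| <= lam) /\
    soft1 lam b - soft1 lam a = d%:R * (b - a)) ->
  \forall b \near a, forall d, (if d then lam <= `|b| else `|b| <= lam) ->
    (if d then lam <= `|a| else `|a| <= lam) /\
    soft1 lam b - soft1 lam a = d%:R * (b - a).
  move=> /andP[loa ahi] affine; near=> b => d; apply: affine.
  by apply/andP; split; near: b; [exact: lt_nbhsr|exact: lt_nbhsl].
have [aN|aN] := ltP a (- lam).
  apply: (step (a - 1) (- lam)) => [|b d /andP[_ bN]].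
    by apply/andP; split; lra.
  case: d => [_|/ler_normlP[]]; last by lra.
  rewrite ler_normr; split; first by apply/orP; right; lra.
  by rewrite !soft1_neg ?ltW// mul1r; ring.
have [aP|aP] := ltP lam a.
  apply: (step lam (a + 1)) => [|b d /andP[bP _]].
    by apply/andP; split; lra.
  case: d => [_|/ler_normlP[]]; last by lra.
  rewrite ler_normr; split; first by apply/orP; left; lra.
  by rewrite !soft1_pos ?ltW// mul1r; ring.
have sa : soft1 lam a = 0 by rewrite soft1_mid ?aN.
(* In the first case [a] is the kink [- lam]; ending the interval at 0 leaves [b <= - lam] as the
   only way to have |b| >= lam. *)
have [aE|aE] := leP a (- lam).
  apply: (step (a - 1) 0) => [|b d /andP[_ b0]].
    by apply/andP; split; lra.
  case: d; rewrite !(ler_normr, ler_norml) sa;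
    [move=> /orP[] b1|move=> /andP[b1 b3]].
  - by lra.
  - split; first by apply/orP; right; lra.
    by rewrite soft1_neg ?mul1r; lra.
  - by split; [apply/andP; split; lra|rewrite soft1_mid ?b1 ?mul0r; lra].
have [aE'|aE'] := leP lam a.
  apply: (step 0 (a + 1)) => [|b d /andP[b0 _]].
    by apply/andP; split; lra.
  case: d; rewrite !(ler_normr, ler_norml) sa;
    [move=> /orP[] b1|move=> /andP[b1 b3]].
  - split; first by apply/orP; left; lra.
    by rewrite soft1_pos ?mul1r; lra.
  - by lra.
  - by split; [apply/andP; split; lra|rewrite soft1_mid ?b1 ?mul0r; lra].
apply: (step (- lam) lam) => [|b d /andP[b1 b2]]; first by rewrite aE.
case: d; rewrite !(ler_normr, ler_norml) sa; [by move=> /orP[]; lra|move=> _].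
by rewrite aN aP soft1_mid ?ltW// mul0r subrr.
Unshelve. all: by end_near. Qed.

Lemma prox_norm1 lam n (v : 'cV[R]_n) : 0 <= lam ->
  prox (@dotv R n) (fun x => lam * norm1 x) v = soft lam v.
Proof.
move=> lam0; apply: prox_subgradient.
- exact: dotvC.
- exact: dotvBl.
- exact: dotv_ge0.
- exact: dotv_eq0.
move=> y; rewrite /norm1 !mulr_sumr /dotv -big_split.
by apply: ler_sum => i _; rewrite !mxE soft1_subgradient.
Qed.

End SoftThresholding.

(** * The fused prox and its dual *)

Lemma continuous_sum (R : realType) (T : topologicalType) (I : Type) (r : seq I)
    (P : pred I) (f : I -> T -> R) (x : T) :
  (forall i, P i -> {for x, continuous (f i)}) ->
  {for x, continuous (fun y => \sum_(i <- r | P i) f i y)}.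
Proof.
move=> f_cont; apply: (@cvg_big R _ +%R 0 P) => //.
exact: add_continuous.
Qed.

Lemma continuous_dotv (R : realType) (n : nat) (T : topologicalType)
    (f g : T -> 'cV[R]_n) (x : T) :
  (forall i, {for x, continuous (fun y => f y i 0)}) ->
  (forall i, {for x, continuous (fun y => g y i 0)}) ->
  {for x, continuous (fun y => dotv (f y) (g y))}.
Proof.
by move=> f_cont g_cont; apply: continuous_sum => i _; exact: continuousM.
Qed.

Lemma continuous_mulmx_coord (R : realType) (m n : nat) (T : topologicalType)
    (A : 'M[R]_(m, n)) (f : T -> 'cV[R]_n) (x : T) (i : 'I_m) :
  (forall j, {for x, continuous (fun y => f y j 0)}) ->
  {for x, continuous (fun y => (A *m f y) i 0)}.
Proof.
move=> f_cont; rewrite (_ : (fun y => _) = fun y => \sum_j A i j * f y j 0).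
  apply: continuous_sum => j _; apply: continuousM => //.
  exact: cst_continuous.
by apply/funext => y; rewrite mxE.
Qed.

Lemma coordB (R : realType) (n : nat) (x y : 'cV[R]_n) i :
  (x - y) i 0 = x i 0 - y i 0.
Proof. by rewrite !mxE. Qed.

Section FusedProx.
Variables (R : realType) (L : nat).
Implicit Types (lam : R) (v w x : 'cV[R]_L) (z : 'cV[R]_L.-1).
Notation B := (Bmx R L).

Lemma Bmx_row (i : 'I_L.-1) : exists a b : 'I_L, [/\ a = i :> nat,
  b = i.+1 :> nat & forall j, B i j = (j == a)%:R - (j == b)%:R].
Proof.
have iL : (i.+1 < L)%N by rewrite -ltn_predRL.
by exists (Ordinal (ltnW iL)), (Ordinal iL); split=> // j; rewrite mxE.
Qed.

Lemma mul_Bmx v (i : 'I_L.-1) (a b : 'I_L) :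
  (forall j, B i j = (j == a)%:R - (j == b)%:R) ->
  (B *m v) i 0 = v a 0 - v b 0.
Proof.
move=> Bi; rewrite mxE; under eq_bigr do rewrite Bi mulrBl.
have pick c : \sum_j (j == c)%:R * v j 0 = v c 0.
  rewrite (bigD1 c)//= eqxx mul1r big1 ?addr0// => j /negPf ->.
  by rewrite mul0r.
by rewrite sumrB !pick.
Qed.

(** Summing the first i + 1 coordinates telescopes the differences. Injectivity of [B^T] later
    recovers z from x and makes the Gram matrices invertible. *)
Lemma trBmx_linv : exists T : 'M[R]_(L.-1, L), T *m B^T = 1%:M.
Proof.
exists (\matrix_(i, j) (j <= i)%N%:R); apply/matrixP => i k; rewrite !mxE.
have [a [b [ak bk Bk]]] := Bmx_row k.
under eq_bigr do rewrite mxE [_^T _ _]mxE Bk mulrBr.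
have pick c : \sum_(j < L) (j <= i)%N%:R * (j == c)%:R = (c <= i)%N%:R :> R.
  rewrite (bigD1 c)//= eqxx mulr1 big1 ?addr0// => j /negPf ->.
  by rewrite mulr0.
rewrite sumrB !pick ak bk -val_eqE /=.
by case: (ltngtP i k) => _; rewrite /= ?subrr ?subr0.
Qed.

(** With x = v - B^T z, this says that z is a subgradient of lam times the l1 norm at B x, written
    as equality in y_i z_i <= lam |y_i| for y = B x. *)
Definition dual_kkt lam v z := (forall i, `|z i 0| <= lam) /\
  forall i, (B *m (v - B^T *m z)) i 0 * z i 0 =
    lam * `|(B *m (v - B^T *m z)) i 0|.

Lemma dual_minimizer_exists lam (u : 'cV[R]_L.-1) : 0 <= lam ->
  exists z, (forall i, `|z i 0| <= lam) /\
    forall z', (forall i, `|z' i 0| <= lam) ->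
    2^-1 * dotv (B^T *m z) (B^T *m z) - dotv z u <=
    2^-1 * dotv (B^T *m z') (B^T *m z') - dotv z' u.
Proof.
move=> lam0.
pose q z := 2^-1 * dotv (B^T *m z) (B^T *m z) - dotv z u.
pose box := [set r : 'rV[R]_L.-1 | forall i, `[- lam, lam]%classic (r 0 i)].
have boxP (r : 'rV[R]_L.-1) : box r <-> forall i, `|r^T i 0| <= lam.
  by split=> rb i; have := rb i; rewrite mxE /= in_itv /= ler_norml.
have [|||r] := @EVT_min_rV R _ (fun r => q r^T) box.
- by exists 0; apply/boxP => i; rewrite !mxE normr0.
- apply: (@rV_compact R _ (fun=> `[- lam, lam]%classic)) => i.
  exact: segment_compact.
- apply: continuous_subspaceT => r.
  have r_cont i : {for r, continuous (fun r : 'rV[R]_L.-1 => r^T i 0)}.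
    rewrite (_ : (fun _ => _) = fun r : 'rV[R]_L.-1 => r 0 i).
      exact: coord_continuous.
    by apply/funext => y; rewrite mxE.
  have sq_cont : {for r, continuous
      (fun r => 2^-1 * dotv (B^T *m r^T) (B^T *m r^T))}.
    apply: continuousM; first exact: cst_continuous.
    by apply: continuous_dotv => i; exact: continuous_mulmx_coord.
  have lin_cont : {for r, continuous (fun r => dotv r^T u)}.
    by apply: continuous_dotv => // i; exact: cst_continuous.
  exact: (continuousB sq_cont lin_cont).
- rewrite inE => /boxP rb rmin; exists r^T; split=> // z' z'b.
  rewrite -[z']trmxK; apply: rmin; rewrite inE; apply/boxP.
  by rewrite trmxK.
Qed.

(** If complementarity failed at i, moving the i-th coordinate of z towards the bound with the sign
    of [y i 0] would stay in the box and lower the dual objective. *)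
Lemma z_fused_kkt lam v : 0 <= lam -> dual_kkt lam v (z_fused lam (B *m v)).
Proof.
move=> lam0; rewrite /z_fused /argmin; set D := (X in xget 0 X).
(* A minimizer exists, so [xget] does not fall back on its default 0. *)
have /(xgetPex 0) : exists z, D z.
  by have [z] := dual_minimizer_exists (B *m v) lam0; exists z.
rewrite -/D; move: (xget 0 D) => z [/= zb zmin]; split=> // i.
set y := B *m (v - B^T *m z).
have yz_le : y i 0 * z i 0 <= lam * `|y i 0|.
  by rewrite (le_trans (ler_norm _))// normrM mulrC ler_wpM2r.
apply/eqP; rewrite eq_le yz_le /=.
have q_expand z' : 2^-1 * dotv (B^T *m (z + z')) (B^T *m (z + z'))
    - dotv (z + z') (B *m v) =
    2^-1 * dotv (B^T *m z) (B^T *m z) - dotv z (B *m v) - dotv z' y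
    + 2^-1 * dotv (B^T *m z') (B^T *m z').
  rewrite /y mulmxBr dotvBr !mulmxDr !dotvDl !dotvDr.
  have -> : dotv z' (B *m (B^T *m z)) = dotv (B^T *m z') (B^T *m z).
    by rewrite dotv_mul trmxK.
  by rewrite (dotvC (B^T *m z) (B^T *m z')); lra.
(* The point of the interval [-lam, lam] that maximizes the product with [y i 0]. *)
pose s := if 0 <= y i 0 then lam else - lam.
have ys : y i 0 * s = lam * `|y i 0|.
  rewrite /s; have [y0|y0] := lerP 0 (y i 0).
    by rewrite ger0_norm// mulrC.
  by rewrite ltr0_norm// mulrN mulrC mulrN.
have s_lam : `|s| = lam by rewrite /s; case: ifP; rewrite ?normrN ger0_norm.
pose e : 'cV[R]_L.-1 := (s - z i 0) *: delta_mx i 0.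
have ey : dotv e y = (s - z i 0) * y i 0.
  rewrite /e dotvZl; congr (_ * _); rewrite /dotv (bigD1 i)//= mxE !eqxx mul1r.
  by rewrite big1 ?addr0// => j /negPf ji; rewrite mxE ji mul0r.
have e_coord j : e j 0 = (s - z i 0) * (j == i)%:R by rewrite !mxE eqxx andbT.
rewrite -ys -subr_le0 -mulrBr mulrC -ey.
clearbody e; have: 0 <= dotv (B^T *m e) (B^T *m e) by exact: dotv_ge0.
set c := dotv _ _ => c0.
have step t : 0 <= t <= 1 -> 0 <= - t * dotv e y + 2^-1 * (t ^+ 2 * c).
  move=> /andP[t0 t1]; have := zmin (z + t *: e).
  rewrite q_expand -!scalemxAr !dotvZl dotvZr -/c => zt.
  suff /zt : forall j, `|(z + t *: e) j 0| <= lam by lra.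
  move=> j; rewrite !mxE e_coord; have [->|ji] := eqVneq j i; last first.
    by rewrite !(mulr0, addr0).
  have -> : z i 0 + t * ((s - z i 0) * 1) = (1 - t) * z i 0 + t * s by ring.
  rewrite (le_trans (ler_normD _ _))// !normrM s_lam.
  have t1' : 0 <= 1 - t by rewrite subr_ge0.
  by rewrite (ger0_norm t0) (ger0_norm t1'); have := ler_wpM2l t1' (zb i); lra.
rewrite leNgt; apply/negP => g0.
(* With g = [dotv e y] > 0, the change - t g + t^2 c / 2 is negative at t = g / (g + c), which lies
   in [0, 1] even when c = 0. *)
have gc : 0 < dotv e y + c by rewrite ltr_wpDr.
have := step (dotv e y / (dotv e y + c)).
rewrite divr_ge0 ?(ltW g0) ?(ltW gc)// ler_pdivrMr// mul1r lerDl c0 => /(_ isT).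
have: 0 < dotv e y / (dotv e y + c) * (dotv e y + 2^-1 * c) *
  (dotv e y / (dotv e y + c)) by rewrite !mulr_gt0 ?invr_gt0//; lra.
rewrite (_ : _ + _ * (_ * _) = - (dotv e y / (dotv e y + c) *
  (dotv e y + 2^-1 * c) * (dotv e y / (dotv e y + c)))); first by lra.
by field; rewrite gt_eqF.
Qed.

(** The subdifferential of the l1 norm is monotone, so B (x - x') and z - z' have nonnegative inner
    product; substituting v - v' = (x - x') + B^T (z - z') makes v -> x firmly nonexpansive. *)
Lemma dual_kkt_mono lam v v' z z' : dual_kkt lam v z -> dual_kkt lam v' z' ->
  dotv ((v - B^T *m z) - (v' - B^T *m z')) ((v - B^T *m z) - (v' - B^T *m z'))
  <= dotv ((v - B^T *m z) - (v' - B^T *m z')) (v - v').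
Proof.
set x := v - B^T *m z; set x' := v' - B^T *m z' => -[zb xz] [zb' xz'].
have bound (y : R) i z1 z2 : (forall i, `|z2 i 0| <= lam) ->
    y * z1 i 0 = lam * `|y| -> 0 <= y * (z1 - z2) i 0.
  move=> z2b yz1; rewrite !mxE mulrBr yz1 subr_ge0 (le_trans (ler_norm _))//.
  by rewrite normrM mulrC ler_wpM2r.
have : 0 <= dotv (B *m (x - x')) (z - z').
  apply: sumr_ge0 => i _; rewrite mulmxBr.
  have -> : (B *m x - B *m x') i 0 = (B *m x) i 0 - (B *m x') i 0.
    exact: coordB.
  rewrite mulrBl addr_ge0 ?(bound _ _ _ _ zb' (xz i))// -mulrN.
  have -> : - (z - z') i 0 = (z' - z) i 0 by rewrite !mxE opprB.
  exact: bound zb (xz' i).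
have -> : v - v' = (x - x') + B^T *m (z - z').
  rewrite mulmxBr /x /x'; move: (B^T *m z) (B^T *m z') => w w'.
  by apply/matrixP => i j; rewrite !mxE; ring.
by rewrite dotv_mul (dotvDr (x - x')) lerDl.
Qed.

Lemma soft0 n (y : 'cV[R]_n) : soft 0 y = y.
Proof. by apply/matrixP => i j; rewrite mxE ord1 soft1_0. Qed.

Definition fused_lasso lam1 lam2 v := lam1 * norm1 v + lam2 * norm1 (B *m v).

(* [soft1 lam1] is monotone, so [B *m soft lam1 x] keeps the sign pattern of
   [B *m x] and [B^T *m z] stays a subgradient of the fused term there. *)
Lemma fused_lasso_subgradient lam1 lam2 v z : 0 <= lam1 -> 0 <= lam2 ->
  dual_kkt lam2 v z -> let s := soft lam1 (v - B^T *m z) in forall y,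
  fused_lasso lam1 lam2 s + dotv (y - s) (v - s) <= fused_lasso lam1 lam2 y.
Proof.
move=> lam10 lam20 [zb xz]; set x := v - B^T *m z in xz * => s y.
(* The residual splits into a subgradient of the l1 term and one of the fused term, treated in
   [sub1] and [sub2]. *)
have vx : v - s = (x - s) + B^T *m z by rewrite addrAC /x subrK.
have sE i : s i 0 = soft1 lam1 (x i 0) by rewrite mxE.
clearbody s x.
have sub1 : lam1 * norm1 s + dotv (y - s) (x - s) <= lam1 * norm1 y.
  rewrite /norm1 !mulr_sumr /dotv -big_split; apply: ler_sum => i _.
  by rewrite !coordB sE; exact: soft1_subgradient.
(* Where x jumps, [xz] forces [z i 0] to be [lam2] or [- lam2], and the jump of s has the same weak
   sign; where x does not jump, neither does s. *)
have sz i : (B *m s) i 0 * z i 0 = lam2 * `|(B *m s) i 0|.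
  have [a [b [_ _ Bi]]] := Bmx_row i; have := xz i.
  rewrite !(mul_Bmx _ Bi) !sE; have [xab|xab|->] := ltgtP (x a 0) (x b 0).
  - rewrite !ler0_norm ?subr_le0 ?soft1_mono ?(ltW xab)// => xzi.
    suff -> : z i 0 = - lam2 by ring.
    apply: (@mulfI _ (x a 0 - x b 0)); first by rewrite subr_eq0 lt_eqF.
    by rewrite xzi; ring.
  - rewrite !ger0_norm ?subr_ge0 ?soft1_mono ?(ltW xab)// => xzi.
    suff -> : z i 0 = lam2 by rewrite mulrC.
    apply: (@mulfI _ (x a 0 - x b 0)); first by rewrite subr_eq0 gt_eqF.
    by rewrite xzi mulrC.
  - by rewrite !subrr normr0 mulr0 mul0r.
have sub2 : lam2 * norm1 (B *m s) + dotv (y - s) (B^T *m z) <=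
    lam2 * norm1 (B *m y).
  rewrite -dotv_mul mulmxBr dotvBl.
  rewrite (_ : dotv (B *m s) z = lam2 * norm1 (B *m s)).
    rewrite addrC subrK /norm1 mulr_sumr; apply: ler_sum => i _.
    by rewrite (le_trans (ler_norm _))// normrM mulrC ler_wpM2r.
  by rewrite /norm1 mulr_sumr; apply: eq_bigr => i _.
by rewrite vx dotvDr /fused_lasso; lra.
Qed.

(** The case [lam1 = 0] of [fused_lasso_subgradient], where soft thresholding is the identity. *)
Lemma x_fusedE lam v : 0 <= lam ->
  x_fused lam v = v - B^T *m z_fused lam (B *m v).
Proof.
move=> lam0; apply: prox_subgradient.
- exact: dotvC.
- exact: dotvBl.
- exact: dotv_ge0.
- exact: dotv_eq0.
move=> y; have := fused_lasso_subgradient (lexx 0) lam0 (z_fused_kkt v lam0) y.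
by rewrite /fused_lasso soft0 !mul0r !add0r.
Qed.

Lemma x_fused_continuous lam i : 0 <= lam ->
  continuous (fun v => x_fused lam v i 0).
Proof.
move=> lam0 v; apply/(@cvgrPdist_lt _ _ _ (nbhs v)) => e e0.
(* Firm nonexpansiveness together with 0 <= |d - u|^2 gives |d|^2 <= |u|^2. *)
have lip w :
    dotv (x_fused lam v - x_fused lam w) (x_fused lam v - x_fused lam w) <=
    dotv (v - w) (v - w).
  have := dual_kkt_mono (z_fused_kkt v lam0) (z_fused_kkt w lam0).
  rewrite -!x_fusedE//.
  move: (x_fused lam v - x_fused lam w) (v - w) => d u mono.
  by have := dotv_ge0 (d - u); rewrite dotvBr !dotvBl (dotvC u d); lra.
have v_cont j : {for v, continuous (fun w : 'cV[R]_L => (v - w) j 0)}.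
  rewrite (_ : (fun _ => _) = fun w : 'cV[R]_L => v j 0 - w j 0).
    apply: (@continuousB _ _ _ (cst (v j 0)) (fun w : 'cV[R]_L => w j 0)).
      exact: cst_continuous.
    exact: coord_continuous.
  by apply/funext => w; exact: coordB.
have := continuous_dotv v_cont v_cont.
move=> /(@cvgrPdist_lt _ _ _ (nbhs v)) /(_ (e ^+ 2)).
rewrite exprn_gt0// => /(_ isT) near_v.
apply: filterS near_v => w.
rewrite subrr dotv0l sub0r normrN ger0_norm ?dotv_ge0// => vw.
rewrite -(@ltr_pXn2r _ 2) ?nnegrE ?normr_ge0 ?ltW//.
rewrite -normrX ger0_norm ?sqr_ge0//.
have -> : x_fused lam v i 0 - x_fused lam w i 0 =
  (x_fused lam v - x_fused lam w) i 0 by rewrite coordB.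
by rewrite (le_lt_trans (dotv_coord _ _))// (le_lt_trans (lip _)).
Qed.

(** Since B^T z = v - x, a left inverse of [B^T] writes z as a linear image of the continuous map v
    - x. *)
Lemma z_fused_continuous lam i : 0 <= lam ->
  continuous (fun v => z_fused lam (B *m v) i 0).
Proof.
move=> lam0 v; have [T TB] := trBmx_linv.
rewrite (_ : (fun _ => _) = fun v => (T *m (v - x_fused lam v)) i 0).
  apply: (@continuous_mulmx_coord _ _ _ _ _ (fun w => w - x_fused lam w)) => j.
  rewrite (_ : (fun _ => _) = fun w : 'cV[R]_L => w j 0 - x_fused lam w j 0).
    apply: (@continuousB _ _ _ (fun w : 'cV[R]_L => w j 0)).
      exact: coord_continuous.
    exact: x_fused_continuous.
  by apply/funext => w; exact: coordB.
by apply/funext => w; rewrite x_fusedE// opprB addrC subrK mulmxA TB mul1mx.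
Qed.

End FusedProx.

(** * The B-subdifferential of soft thresholding *)

Lemma cvg_mx_coord (R : realType) (m n : nat) (T : Type) (F : set_system T)
    (FF : Filter F) (f : T -> 'M[R]_(m, n)) (M : 'M[R]_(m, n)) :
  (forall i j, (fun x => f x i j) @ F --> M i j) -> f @ F --> M.
Proof.
move=> fM A [P PM PA].
have near_ij : \forall x \near F, forall i j, P i j (f x i j).
  by apply: filter_forall => i; apply: filter_forall => j; exact: fM (PM i j).
by apply: filterS near_ij => x Px; exact: PA.
Qed.

(** The remainder of the expansion is identically zero near [u], hence little-o. *)
Lemma near_affine_diff (R : realType) (V W : normedModType R) (f : V -> W)
    (df : {linear V -> W}) (u : V) : continuous df ->
  (\forall w \near u, f w = f u + df (w - u)) ->
  differentiable f u /\ 'd f u = df :> (V -> W).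
Proof.
move=> df_cont fA.
have fA0 : \forall h \near (0 : V), f (h + u) = f u + df h.
  move: fA; rewrite (near_shift 0 u) subr0; apply: filterS => h /=.
  by rewrite addrK.
have f_diff : f \o shift u = cst (f u) + df +o_ 0 id.
  apply/eqaddoP => _/posnumP[e]; apply: filterS fA0 => h fh.
  rewrite [X in `|X|](_ : _ = 0) ?normr0 ?mulr_ge0//.
  by rewrite -[LHS]/(f (h + u) - (f u + df h)) fh subrr.
have dfE := diff_unique df_cont f_diff.
by split=> //; apply/diff_locallyP; rewrite dfE.
Qed.

Lemma mulmx_continuous (R : realType) (m n : nat) (A : 'M[R]_(m, n)) :
  continuous (fun x : 'cV[R]_n => A *m x).
Proof.
move=> x; apply: (@cvg_mx_coord _ _ _ _ (nbhs x)) => i j; rewrite ord1.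
apply: (@continuous_mulmx_coord _ _ _ _ _ id) => k; exact: coord_continuous.
Qed.

Lemma near_affine_jacobmx (R : realType) (m n : nat) (A : 'M[R]_(m, n))
    (f : 'cV[R]_n -> 'cV[R]_m) (u : 'cV[R]_n) :
  (\forall w \near u, f w = f u + A *m (w - u)) ->
  differentiable f u /\ jacobmx f u = A.
Proof.
move=> /(@near_affine_diff _ _ _ f (mulmx A) u (@mulmx_continuous _ _ _ A)).
move=> [f_diff dfE]; split=> //; apply/matrixP => i j.
by rewrite mxE dfE /= -colE mxE.
Qed.

Section SoftJacobian.
Variable R : realType.
Implicit Types (lam a b c : R).

Lemma soft1_slope_exists lam a : exists d, soft1_slope lam a d.
Proof.
exists (lam <= `|a|); rewrite /soft1_slope; have [al|al] := lerP lam `|a| => //.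
by rewrite ltW// (le_lt_trans _ al)/=.
Qed.

(** The admissible values form a subset of {0, 1}, which is finite and therefore closed. *)
Lemma cvg_bool (T : Type) (F : set_system T) (FF : ProperFilter F)
    (f : T -> R) (P : bool -> Prop) c : f @ F --> c ->
  (\forall x \near F, exists d : bool, P d /\ f x = d%:R) ->
  exists d : bool, P d /\ c = d%:R.
Proof.
move=> fc fP; pose D : set R := [set r | exists d : bool, P d /\ r = d%:R].
have : closed D.
  apply: (proj1 accessible_finite_set_closed).
    exact: hausdorff_accessible (@Rhausdorff _).
  apply: (@sub_finite_set _ _ [set 0; 1]) => [r [[] [_ ->]]|].
  - by right.
  - by left.
  - exact: finite_set2.
move=> D_closed; suff : D c by [].
exact: (@closed_cvg _ _ F _ f D D_closed fP c fc).
Qed.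

(** By [soft1_affine], every difference quotient close to [a] already equals a slope admissible at
    [a], so the limit does too. *)
Lemma soft1_derivative lam a c : 0 <= lam ->
  h^-1 * (soft1 lam (h + a) - soft1 lam a) @[h --> 0^'] --> c ->
  exists d : bool, soft1_slope lam a d /\ c = d%:R.
Proof.
move=> lam0 /cvg_bool; apply.
rewrite /dnbhs near_withinE; have := soft1_affine a lam0.
rewrite (near_shift 0 a) subr0; apply: filterS => h /= affine h0.
have [d hd] := soft1_slope_exists lam (h + a); exists d.
have [ad ->] := affine d hd; split=> //.
by rewrite addrK mulrCA mulVf ?mulr1.
Qed.

Lemma soft_difference_quotient lam n (u : 'cV[R]_n) i j (h : R) :
  (h^-1 *: ((@soft R lam n \o shift u) (h *: delta_mx j 0) - soft lam u)) i 0 =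
  if i == j then h^-1 * (soft1 lam (h + u i 0) - soft1 lam (u i 0)) else 0.
Proof.
rewrite !mxE eqxx andbT.
by case: eqP => [->|_]; rewrite ?mulr1 ?mulr0 ?add0r ?subrr ?mulr0.
Qed.

(** Jacobian entries are limits of difference quotients: zero off the diagonal, and one-dimensional
    on it. The points of differentiability need not be located. *)
Lemma jacobmx_soft lam n (u : 'cV[R]_n) : 0 <= lam ->
  differentiable (@soft R lam n) u -> exists d : 'I_n -> bool,
    (forall i, soft1_slope lam (u i 0) (d i)) /\
    jacobmx (@soft R lam n) u = diag_mx (\row_i (d i)%:R).
Proof.
move=> lam0 u_diff.
have quot i j : (if i == j
    then h^-1 * (soft1 lam (h + u i 0) - soft1 lam (u i 0)) else 0)
    @[h --> 0^'] --> jacobmx (@soft R lam n) u i j.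
  rewrite mxE -deriveE//.
  under eq_fun do rewrite -soft_difference_quotient.
  have /cvg_ex[l lP] := @diff_derivable _ _ _ _ _ (delta_mx j 0) u_diff.
  have cvD : (fun h => h^-1 *:
      ((@soft R lam n \o shift u) (h *: delta_mx j 0) - soft lam u)) @ 0^' -->
      'D_(delta_mx j 0) (@soft R lam n) u.
    by rewrite /derive (cvg_lim (@norm_hausdorff _ _) lP).
  exact: (cvg_comp _ (fun x : 'cV[R]_n => x i 0) cvD
    (@coord_continuous _ _ _ i 0 _)).
have /choice[d dP] i : exists d : bool, soft1_slope lam (u i 0) d /\
    jacobmx (@soft R lam n) u i i = d%:R.
  by apply: soft1_derivative => //; have := quot i i; rewrite eqxx.
exists d; split=> [i|]; first by have [] := dP i.
apply/matrixP => i j; rewrite !mxE; have [<-|ij] := eqVneq i j.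
  by have [_ <-] := dP i; rewrite mulr1n mxE.
have := quot i j; rewrite (negPf ij) => q.
rewrite mxE in q; rewrite -(cvg_lim (@Rhausdorff _) q).
exact: (cvg_lim (@Rhausdorff _) (cvg_cst 0)).
Qed.

(** Limits of Jacobians stay diagonal with 0-1 entries, and slopes admissible near y are admissible
    at y. Conversely, any admissible pattern is attained along a sequence of points lying strictly
    inside the corresponding pieces. *)
Lemma Bsubdiff_soft lam n (y : 'cV[R]_n) (J : 'M[R]_n) : 0 <= lam ->
  Bsubdiff (@soft R lam n) y J <-> exists d : 'I_n -> bool,
    (forall i, soft1_slope lam (y i 0) (d i)) /\ J = diag_mx (\row_i (d i)%:R).
Proof.
move=> lam0; split=> [[u [u_diff uy uJ]]|[d [dP ->]]].
  have /choice[d dP] k := jacobmx_soft lam0 (u_diff k).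
  have Jij i j : jacobmx (@soft R lam n) (u k) i j @[k --> \oo] --> J i j.
    exact: (cvg_comp _ (fun M : 'M[R]_n => M i j) uJ
      (@coord_continuous _ _ _ i j _)).
  have /choice[e eP] i : exists e, soft1_slope lam (y i 0) e /\ J i i = e%:R.
    apply: (cvg_bool _ (Jij i i)).
    have ui : u k i 0 @[k --> \oo] --> y i 0.
      exact: (cvg_comp _ (fun x : 'cV[R]_n => x i 0) uy
        (@coord_continuous _ _ _ i 0 _)).
    have near_i : \forall k \near \oo, forall e, soft1_slope lam (u k i 0) e ->
        soft1_slope lam (y i 0) e /\
        soft1 lam (u k i 0) - soft1 lam (y i 0) = e%:R * (u k i 0 - y i 0).
      exact: (ui _ (soft1_affine (y i 0) lam0)).
    apply: filterS near_i => k /= affine; exists (d k i).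
    have [slope ->] := dP k; have [? _] := affine _ (slope i).
    by rewrite !mxE eqxx mulr1n.
  exists e; split=> [i|]; first by have [] := eP i.
  apply/matrixP => i j; rewrite !mxE; have [<-|ij] := eqVneq i j.
    by have [_ <-] := eP i; rewrite mulr1n.
  have Jk k : jacobmx (@soft R lam n) (u k) i j = 0.
    by have [_ ->] := dP k; rewrite !mxE (negPf ij) mulr0n.
  have := Jij i j; under eq_fun do rewrite Jk.
  move=> q; rewrite mulr0n -(cvg_lim (@Rhausdorff _) q).
  exact: (cvg_lim (@Rhausdorff _) (cvg_cst 0)).
(* Coordinates meant to have slope 1 are pushed away from 0, the others are shrunk towards 0; both
   moves make the threshold inequality strict. *)
pose delta : 'cV[R]_n :=
  \col_i (if d i then if 0 <= y i 0 then 1 else -1 else - y i 0).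
pose u (k : nat) : 'cV[R]_n := y + harmonic k *: delta.
have u_strict k i : if d i then lam < `|u k i 0| else `|u k i 0| < lam.
  have -> : u k i 0 = y i 0 + harmonic k *
      (if d i then if 0 <= y i 0 then 1 else -1 else - y i 0) by rewrite !mxE.
  have t0 : 0 < harmonic k :> R by rewrite invr_gt0.
  have t1 : harmonic k <= 1 :> R by rewrite invf_le1 ?ler1n.
  move: (harmonic k) t0 t1 (dP i) => t t0 t1; rewrite /soft1_slope.
  case: (d i) => [|/andP[l0 yl]].
    have [y0|y0] := lerP 0 (y i 0).
      by rewrite !ger0_norm ?addr_ge0 ?mulr1 ?(ltW t0)//; lra.
    by rewrite !ltr0_norm ?mulrN1; lra.
  have -> : y i 0 + t * - y i 0 = (1 - t) * y i 0 by ring.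
  have t1' : 0 <= 1 - t by lra.
  rewrite normrM (ger0_norm t1') (le_lt_trans (ler_wpM2l t1' yl))//.
  by rewrite mulrBl mul1r ltrBlDr ltrDl mulr_gt0.
have u_cvg : u @ \oo --> y.
  rewrite -[X in _ --> X]addr0 -(scale0r delta).
  apply: cvgD; first exact: cvg_cst.
  by apply: cvgZ; [exact: cvg_harmonic|exact: cvg_cst].
clearbody u.
have u_affine k : \forall w \near u k,
    soft lam w = soft lam (u k) + diag_mx (\row_i (d i)%:R) *m (w - u k).
  have near_i : \forall w \near u k, forall i, forall e,
      soft1_slope lam ((w : 'cV[R]_n) i 0) e ->
      soft1_slope lam (u k i 0) e /\
      soft1 lam (w i 0) - soft1 lam (u k i 0) = e%:R * (w i 0 - u k i 0).
    apply: (@filter_forall _ _ _ (nbhs (u k))) => i.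
    exact: (@coord_continuous _ _ _ i 0 (u k) _ (soft1_affine (u k i 0) lam0)).
  apply: filterS near_i => w w_affine; apply/matrixP => i j; rewrite ord1.
  have [e we] := soft1_slope_exists lam (w i 0).
  have [ue wu] := w_affine i e we.
  (* Strictness at [u k] leaves [d i] as the only admissible slope. *)
  have {}ue : e = d i.
    move: ue (u_strict k i); rewrite /soft1_slope.
    case: (d i); case: e {we wu} => //=.
      by move=> /andP[_ /le_lt_trans/[apply]]; rewrite ltxx.
    by move=> /lt_le_trans/[apply]; rewrite ltxx.
  have -> : soft lam w i 0 = soft1 lam (w i 0) by rewrite mxE.
  by rewrite mul_diag_mx !mxE -ue -[e%:R * _]wu addrC subrK.
exists u; split=> [k|//|].
  by have [] := near_affine_jacobmx (u_affine k).
rewrite (_ : (fun k => jacobmx _ (u k)) = fun=> diag_mx (\row_i (d i)%:R)).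
  exact: cvg_cst.
by apply/funext => k; have [] := near_affine_jacobmx (u_affine k).
Qed.

End SoftJacobian.

(** * Projections onto fused vectors *)

Section MoorePenrose.
Variable R : realType.

(** The symmetry equations force A Q = A Q' and Q A = Q' A; then Q = Q A Q = Q' A Q' = Q'. *)
Lemma mpinv_unique m n (A : 'M[R]_(m, n)) (Q Q' : 'M[R]_(n, m)) :
  is_mpinv A Q -> is_mpinv A Q' -> Q = Q'.
Proof.
move=> [aqa qaq tAQ tQA] [aq'a q'aq' tAQ' tQ'A].
have AQE : A *m Q = A *m Q'.
  by rewrite -tAQ -{1}aq'a -mulmxA trmx_mul tAQ tAQ' mulmxA aqa.
have QAE : Q *m A = Q' *m A.
  rewrite -tQA -{1}aq'a !mulmxA -mulmxA trmx_mul tQA tQ'A -mulmxA.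
  by rewrite [A *m (Q *m A)]mulmxA aqa.
by rewrite -qaq -mulmxA AQE mulmxA QAE q'aq'.
Qed.

Lemma mulmx_cV_ext m n (A A' : 'M[R]_(m, n)) :
  (forall x : 'cV[R]_n, A *m x = A' *m x) -> A = A'.
Proof.
move=> AE; apply/matrixP => i j.
by have /matrixP/(_ i 0) := AE (delta_mx j 0); rewrite -!colE !mxE.
Qed.

End MoorePenrose.

Section FusedProjection.
Variables (R : realType) (L : nat) (K : {set 'I_L.-1}).
Notation B := (Bmx R L).
Notation S := (Sigmamx R K).

Lemma Sigmamx_mul n (A : 'M[R]_(L.-1, n)) i j :
  (S *m A) i j = (i \notin K)%:R * A i j.
Proof. by rewrite mul_diag_mx !mxE. Qed.

Lemma tr_Sigmamx : S^T = S.
Proof. exact: tr_diag_mx. Qed.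

Lemma Sigmamx_idem : S *m S = S.
Proof.
apply/matrixP => i j; rewrite Sigmamx_mul !mxE.
by case: (i \in K); rewrite ?mul0r ?mul1r ?mul0rn.
Qed.

(* [Sigma B B^T Sigma] made invertible by the identity on the kernel of
   [Sigma]; its inverse cut down by [Sigma] is the pseudoinverse. *)
Definition fused_gram : 'M[R]_L.-1 := S *m B *m B^T *m S + (1%:M - S).

Definition fused_pinv : 'M[R]_L.-1 := S *m invmx fused_gram.

(** The orthogonal projection onto the vectors y with (B y)_i = 0 for i outside [K]: it is
    symmetric, maps into that subspace and fixes it. *)
Definition fused_proj : 'M[R]_L := 1%:M - B^T *m fused_pinv *m B.

Lemma tr_fused_gram : fused_gram^T = fused_gram.
Proof.
by rewrite linearD linearB /= trmx1 !trmx_mul trmxK tr_Sigmamx !mulmxA.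
Qed.

Lemma Sigmamx_gram : S *m fused_gram = S *m B *m B^T *m S.
Proof.
by rewrite mulmxDr mulmxBr mulmx1 Sigmamx_idem subrr addr0 !mulmxA Sigmamx_idem.
Qed.

Lemma gram_Sigmamx : fused_gram *m S = S *m B *m B^T *m S.
Proof.
rewrite mulmxDl mulmxBl mul1mx Sigmamx_idem subrr addr0.
by rewrite -!mulmxA Sigmamx_idem.
Qed.

(** The quadratic form at x is |B^T S x|^2 + |(1 - S) x|^2. If it vanishes, injectivity of [B^T]
    gives S x = 0, and then x = (1 - S) x = 0. *)
Lemma fused_gram_unit : fused_gram \in unitmx.
Proof.
rewrite -row_free_unit; apply: inj_row_free => r rG.
have [T TB] := trBmx_linv R L.
pose x := r^T.
have Gx : fused_gram *m x = 0 by rewrite -tr_fused_gram -trmx_mul rG trmx0.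
have : dotv (B^T *m (S *m x)) (B^T *m (S *m x)) +
    dotv ((1%:M - S) *m x) ((1%:M - S) *m x) = 0.
  transitivity (dotv x (fused_gram *m x)); last by rewrite Gx dotvC dotv0l.
  rewrite /fused_gram [in RHS]mulmxDl (dotvDr _ _ x); congr (_ + _).
    by rewrite dotv_mul trmxK (dotv_mul S) tr_Sigmamx !mulmxA.
  rewrite dotv_mul linearB /= trmx1 tr_Sigmamx; congr (dotv _ _).
  by rewrite mulmxA mulmxBl mul1mx mulmxBr mulmx1 Sigmamx_idem subrr subr0.
have := dotv_ge0 (B^T *m (S *m x)); have := dotv_ge0 ((1%:M - S) *m x).
move=> ge1 ge2 eq0.
have /dotv_eq0 BSx : dotv (B^T *m (S *m x)) (B^T *m (S *m x)) = 0 by lra.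
have /dotv_eq0 : dotv ((1%:M - S) *m x) ((1%:M - S) *m x) = 0 by lra.
have Sx : S *m x = 0 by rewrite -[S *m x]mul1mx -TB -mulmxA BSx mulmx0.
by rewrite mulmxBl mul1mx Sx subr0 => x0; rewrite -[r]trmxK -/x x0 trmx0.
Qed.

Lemma fused_pinvE : fused_pinv = invmx fused_gram *m S.
Proof.
rewrite /fused_pinv -[S in RHS](mulmxK fused_gram_unit) Sigmamx_gram.
by rewrite -gram_Sigmamx !mulmxA mulVmx ?fused_gram_unit// mul1mx.
Qed.

Lemma Sigmamx_pinv : S *m fused_pinv = fused_pinv.
Proof. by rewrite /fused_pinv mulmxA Sigmamx_idem. Qed.

Lemma pinv_Sigmamx : fused_pinv *m S = fused_pinv.
Proof. by rewrite fused_pinvE -mulmxA Sigmamx_idem. Qed.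

Lemma tr_fused_pinv : fused_pinv^T = fused_pinv.
Proof.
rewrite {1}/fused_pinv trmx_mul trmx_inv tr_fused_gram tr_Sigmamx.
by rewrite fused_pinvE.
Qed.

Lemma gram_pinv : S *m B *m B^T *m S *m fused_pinv = S.
Proof.
rewrite -gram_Sigmamx -mulmxA Sigmamx_pinv fused_pinvE mulmxA.
by rewrite mulmxV ?fused_gram_unit// mul1mx.
Qed.

Lemma pinv_gram : fused_pinv *m (S *m B *m B^T *m S) = S.
Proof.
rewrite -Sigmamx_gram mulmxA pinv_Sigmamx /fused_pinv -mulmxA.
by rewrite mulVmx ?fused_gram_unit// mulmx1.
Qed.

Lemma fused_pinv_is_mpinv : is_mpinv (S *m B *m B^T *m S) fused_pinv.
Proof.
split; rewrite ?gram_pinv ?pinv_gram ?tr_Sigmamx ?Sigmamx_pinv//.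
by rewrite !mulmxA Sigmamx_idem.
Qed.

Lemma tr_fused_proj : fused_proj^T = fused_proj.
Proof.
rewrite /fused_proj linearB /= trmx1 trmx_mul (trmx_mul B^T) trmxK.
by rewrite tr_fused_pinv mulmxA.
Qed.

Lemma Sigma_fused_proj : S *m B *m fused_proj = 0.
Proof.
rewrite /fused_proj; move: fused_pinv Sigmamx_pinv gram_pinv => Q SQ GQ.
by rewrite mulmxBr mulmx1 -SQ !mulmxA GQ subrr.
Qed.

Lemma fused_proj_tr : fused_proj *m B^T *m S = 0.
Proof.
have := congr1 trmx Sigma_fused_proj.
by rewrite trmx0 trmx_mul (trmx_mul S) tr_fused_proj tr_Sigmamx mulmxA.
Qed.

Lemma fused_proj_id n (X : 'M[R]_(L, n)) :
  S *m B *m X = 0 -> fused_proj *m X = X.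
Proof.
move=> SBX; rewrite /fused_proj; move: fused_pinv pinv_Sigmamx => Q QS.
by rewrite mulmxBl mul1mx -QS -!mulmxA (mulmxA S) SBX !mulmx0 subr0.
Qed.

(** A pattern [d] constant along fused coordinates makes U preserve the range of the projection P,
    so U P = P U P, which is visibly symmetric and positive semidefinite. *)
Lemma psdmx_diag_proj (d : 'I_L -> bool) :
  (forall i, i \notin K -> forall a b : 'I_L,
     (forall j, B i j = (j == a)%:R - (j == b)%:R) -> d a = d b) ->
  psdmx (diag_mx (\row_i (d i)%:R) *m fused_proj).
Proof.
move=> dK; set U := diag_mx _.
have SBU : S *m B *m (U *m fused_proj) = 0.
  apply: mulmx_cV_ext => x; rewrite mul0mx -!mulmxA; set y := fused_proj *m x.
  have SBy : S *m (B *m y) = 0 by rewrite mulmxA mulmxA Sigma_fused_proj mul0mx.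
  apply/matrixP => i j; rewrite ord1 {j} Sigmamx_mul [RHS]mxE.
  have [iK|iK] := boolP (i \in K); first by rewrite mul0r.
  have [a [b [_ _ Bi]]] := Bmx_row R i.
  have : (S *m (B *m y)) i 0 = 0 by rewrite SBy mxE.
  rewrite Sigmamx_mul iK !mul1r !(mul_Bmx _ Bi) => /subr0_eq yab.
  have Uy k : (U *m y) k 0 = (d k)%:R * y k 0 by rewrite mul_diag_mx !mxE.
  by rewrite !Uy yab (dK i iK a b Bi) subrr.
have UP : fused_proj *m (U *m fused_proj) = U *m fused_proj.
  exact: fused_proj_id.
have UPt : (U *m fused_proj)^T = U *m fused_proj.
  by rewrite -[RHS]UP -{1}UP !trmx_mul tr_fused_proj tr_diag_mx mulmxA.
split=> // x; rewrite -UP -{1}tr_fused_proj -!mulmxA -dotv_mul.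
move: (fused_proj *m x) => y; apply: sumr_ge0 => i _.
by rewrite mul_diag_mx !mxE mulrCA -expr2 mulr_ge0 ?sqr_ge0.
Qed.

End FusedProjection.

(** * The surrogate Jacobian of one fiber *)

(** Inside the interval no nearby point is extremal; at an endpoint the other endpoint is too far
    away, unless [lam = 0], when both are 0. *)
Lemma near_extremal (R : realType) (lam a : R) : `|a| <= lam ->
  \forall b \near a, `|b| = lam -> `|a| = lam /\ b = a.
Proof.
rewrite le_eqVlt => /predU1P[aE|al].
  have [lam0|lam0] := eqVneq lam 0.
    near=> b => /eqP; rewrite lam0 normr_eq0 => /eqP ->; split=> //.
      by rewrite aE.
    by apply/esym/eqP; rewrite -normr_eq0 aE lam0.
  have lam_gt0 : 0 < lam by rewrite lt_def lam0 -aE normr_ge0.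
  near=> b => bE; split=> //.
  have : `|a - b| < lam by near: b; apply: cvgr_dist_lt => //; exact: cvg_id.
  have [a0|a0] := lerP 0 a; have [b0|b0] := lerP 0 b; move: aE bE;
    rewrite ?(ger0_norm a0) ?(ltr0_norm a0) ?(ger0_norm b0) ?(ltr0_norm b0);
    move=> aE bE.
  - by move=> _; rewrite aE bE.
  - by rewrite ltr_norml; lra.
  - by rewrite ltr_norml; lra.
  - by move=> _; lra.
near=> b => bE; suff : `|b| < lam by rewrite bE ltxx.
have : `|a - b| < lam - `|a|.
  by near: b; apply: cvgr_dist_lt; [exact: cvg_id|rewrite subr_gt0].
rewrite -(normrN (a - b)) opprB => ba.
rewrite -[b](subrK a) (le_lt_trans (ler_normD _ _))//; lra.
Unshelve. all: by end_near. Qed.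

Section SurrogateJacobian.
Variables (R : realType) (L : nat) (lam1 lam2 : R).
Hypotheses (lam1_ge0 : 0 <= lam1) (lam2_ge0 : 0 <= lam2).
Implicit Types (v w : 'cV[R]_L) (M : 'M[R]_L).
Notation B := (Bmx R L).

(** Reduces membership to a sign pattern and an index set, hence to finitely many candidate
    matrices. *)
Lemma dprox_phiP v M : dprox_phi lam1 lam2 v M <-> psdmx M /\
  exists d : 'I_L -> bool, exists K, [/\
    forall i, soft1_slope lam1 (x_fused lam2 v i 0) (d i), Kz lam2 v K &
    M = diag_mx (\row_i (d i)%:R) *m fused_proj R K].
Proof.
have proxE : prox (@dotv R L) (fun x => lam1 * norm1 x) = @soft R lam1 L.
  by apply/funext => x; exact: prox_norm1.
rewrite /dprox_phi /= proxE; split=> -[M_psd].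
  move=> [U [Q [/(Bsubdiff_soft _ _ lam1_ge0)[d [dP ->]] [Q' [K KP]]]]].
  move=> /mpinv_unique/(_ (fused_pinv_is_mpinv R K)) -> <- ME.
  by split=> //; exists d, K; split.
move=> [d [K [dP KP ME]]]; split=> //.
exists (diag_mx (\row_i (d i)%:R)), (fused_proj R K); split=> //.
  by apply/(Bsubdiff_soft _ _ lam1_ge0); exists d.
by exists (fused_pinv R K) => //; exists K => //; exact: fused_pinv_is_mpinv.
Qed.

Lemma dprox_phi_nonempty v : dprox_phi lam1 lam2 v !=set0.
Proof.
set x := x_fused lam2 v; pose K := supp (B *m x).
have [zb xz] := z_fused_kkt v lam2_ge0.
have KP : Kz lam2 v K.
  (* Complementarity at a nonzero jump gives |z_i| = lam2 after cancelling the jump, so the smallest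
     candidate [K] is admissible. *)
  rewrite /Kz /= subxx /=; apply/fintype.subsetP => i; rewrite !inE => xi.
  have := xz i; rewrite -x_fusedE// -/x => /(congr1 Num.norm).
  by rewrite normrM mulrC normrM (ger0_norm lam2_ge0) normr_id => /mulIf ->//;
    rewrite normr_eq0.
(* Depending on [x i 0] alone, this choice takes equal values on fused coordinates, as
   [psdmx_diag_proj] requires. *)
pose d i := lam1 <= `|x i 0|.
exists (diag_mx (\row_i (d i)%:R) *m fused_proj R K).
apply/dprox_phiP; split; last first.
  exists d, K; split=> // i; rewrite /soft1_slope /d -/x.
  have [//|xl] := lerP lam1 `|x i 0|.
  by rewrite ltW// (le_lt_trans _ xl)/=.
apply: psdmx_diag_proj => i; rewrite inE negbK => xi a b Bi.
by move: xi; rewrite (mul_Bmx _ Bi) subr_eq0 /d => /eqP ->.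
Qed.

(* Both the active set of the dual solution and the jumps of the primal one are
   locally semicontinuous, so an admissible [K] at [w] is admissible at [v], and
   on such a [K] the two primal solutions differ by a projection of [w - v]. *)
Lemma dprox_phi_near v : \forall w \near v, forall M, dprox_phi lam1 lam2 w M ->
  dprox_phi lam1 lam2 v M /\
  soft lam1 (x_fused lam2 w) - soft lam1 (x_fused lam2 v) = M *m (w - v).
Proof.
have near_soft : \forall w \near v, forall i d,
    soft1_slope lam1 (x_fused lam2 (w : 'cV[R]_L) i 0) d ->
    soft1_slope lam1 (x_fused lam2 v i 0) d /\
    soft1 lam1 (x_fused lam2 w i 0) - soft1 lam1 (x_fused lam2 v i 0) =
      d%:R * (x_fused lam2 w i 0 - x_fused lam2 v i 0).
  apply: (@filter_forall _ _ _ (nbhs v)) => i.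
  exact: (x_fused_continuous lam2_ge0 (soft1_affine _ lam1_ge0)).
have near_supp : \forall w \near v, forall i,
    (B *m x_fused lam2 v) i 0 != 0 ->
    (B *m x_fused lam2 (w : 'cV[R]_L)) i 0 != 0.
  apply: (@filter_forall _ _ _ (nbhs v)) => i.
  have [Bi|Bi] := eqVneq ((B *m x_fused lam2 v) i 0) 0.
    by apply: filterS filterT => w _.
  have Bcont : {for v, continuous (fun w => (B *m x_fused lam2 w) i 0)}.
    apply: continuous_mulmx_coord => j; exact: x_fused_continuous.
  by apply: filterS (cvgr_neq0 _ Bcont Bi) => w ? _.
have near_dual : \forall w \near v, forall i,
    `|z_fused lam2 (B *m (w : 'cV[R]_L)) i 0| = lam2 ->
    `|z_fused lam2 (B *m v) i 0| = lam2 /\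
    z_fused lam2 (B *m w) i 0 = z_fused lam2 (B *m v) i 0.
  apply: (@filter_forall _ _ _ (nbhs v)) => i.
  have [zb _] := z_fused_kkt v lam2_ge0.
  exact: (z_fused_continuous lam2_ge0 (near_extremal (zb i))).
apply: filterS (filterI near_soft (filterI near_supp near_dual)).
move=> w [w_soft [w_supp w_dual]] M /dprox_phiP[M_psd [d [K [dP]]]].
rewrite /Kz /= => /andP[/fintype.subsetP suppK /fintype.subsetP KI] ME.
have suppK' i : (B *m x_fused lam2 v) i 0 != 0 -> i \in K.
  by move=> /w_supp Bi; apply: suppK; rewrite inE.
have KI' i : i \in K -> `|z_fused lam2 (B *m w) i 0| = lam2.
  by move=> /KI; rewrite inE => /eqP.
split.
  apply/dprox_phiP; split=> //; exists d, K; split=> //.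
    by move=> i; have [] := w_soft i _ (dP i).
  rewrite /Kz /=; apply/andP; split; apply/fintype.subsetP => i; rewrite !inE.
    exact: suppK'.
  by move=> /KI' /w_dual[-> _].
(* Write w - v = dx + B^T dz. The part dz vanishes on [K], so the projection kills B^T dz; the jumps
   of dx vanish off [K], so the projection fixes dx. *)
have x_diff : x_fused lam2 w - x_fused lam2 v = fused_proj R K *m (w - v).
  set dx := _ - _; pose dz := z_fused lam2 (B *m w) - z_fused lam2 (B *m v).
  have -> : w - v = dx + B^T *m dz.
    rewrite /dx /dz !x_fusedE// mulmxBr.
    move: (B^T *m z_fused _ (_ *m w)) (B^T *m z_fused _ (_ *m v)) => a b.
    by apply/matrixP => i j; rewrite !mxE; ring.
  have Sdz : Sigmamx R K *m dz = dz.
    apply/matrixP => i j; rewrite ord1 Sigmamx_mul.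
    have [iK|_] := boolP (i \in K).
      rewrite mul0r coordB; have [_ ->] := w_dual _ (KI' _ iK).
      by rewrite subrr.
    by rewrite mul1r.
  rewrite mulmxDr -Sdz !mulmxA fused_proj_tr mul0mx addr0 fused_proj_id//.
  apply/matrixP => i j.
  rewrite ord1 -mulmxA Sigmamx_mul [RHS]mxE mulmxBr coordB.
  have [_|iK] := boolP (i \in K); first by rewrite mul0r.
  have -> : (B *m x_fused lam2 w) i 0 = 0.
    by apply/eqP; apply: contraNT iK => Bi; apply: suppK; rewrite inE.
  have -> : (B *m x_fused lam2 v) i 0 = 0.
    by apply/eqP; apply: contraNT iK => Bi; exact: suppK'.
  by rewrite subrr mulr0.
rewrite ME -mulmxA -x_diff; apply/matrixP => i j.
rewrite ord1 mul_diag_mx coordB [RHS]mxE coordB ![soft _ _ _ _]mxE.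
by have [_ ->] := w_soft i _ (dP i); rewrite mxE.
Qed.

End SurrogateJacobian.

(** * Matrix families *)

Lemma norm1_Bmx (R : realType) (L : nat) (x : 'cV[R]_L) :
  norm1 (Bmx R L *m x) =
  \sum_(k < L) \sum_(l < L | l == k.+1 :> nat) (`|x l 0 - x k 0| : R).
Proof.
case: L x => [|m] x; first by rewrite /norm1 !big_ord0.
(* The last index has no successor, so its inner sum is empty and only the rows of B remain. *)
rewrite big_ord_recr /= [X in _ + X]big_pred0 ?addr0; last first.
  by move=> l; rewrite ltn_eqF.
apply: eq_bigr => i _; rewrite (big_pred1 (lift ord0 i)) => [|l]; last first.
  by rewrite /= -val_eqE.
have Bi j : Bmx R m.+1 i j =
    (j == widen_ord (leqnSn m) i)%:R - (j == lift ord0 i)%:R by rewrite mxE.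
by rewrite (mul_Bmx x Bi) distrC.
Qed.

Section Glasso.
Variables (R : realType) (L p : nat) (lam1 lam2 : R).
Hypotheses (lam1_ge0 : 0 <= lam1) (lam2_ge0 : 0 <= lam2).
Notation Y := (symfam R L p).
Implicit Types (X Z T : Y) (i j : 'I_p).

Lemma fiber_ext X Z : (forall i j, fiber X i j = fiber Z i j) -> X = Z.
Proof.
move=> XZ; apply/ffunP => l; apply/val_inj/matrixP => i j.
by have /matrixP/(_ l 0) := XZ i j; rewrite !mxE.
Qed.

Lemma fiber_sym X i j : fiber X j i = fiber X i j.
Proof. by apply/matrixP => l k; rewrite !mxE -[in RHS]slice_sym mxE. Qed.

Lemma fiberD X Z i j : fiber (X + Z) i j = fiber X i j + fiber Z i j.
Proof. by apply/matrixP => l k; rewrite !mxE sliceD mxE. Qed.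

Lemma fiberZ a X i j : fiber (a *: X) i j = a *: fiber X i j.
Proof. by apply/matrixP => l k; rewrite !mxE sliceZ mxE. Qed.

Lemma fiberB X Z i j : fiber (X - Z) i j = fiber X i j - fiber Z i j.
Proof. by rewrite -scaleN1r fiberD fiberZ scaleN1r. Qed.

Lemma fiber_onto (F : 'I_p -> 'I_p -> 'cV[R]_L) : (forall i j, F j i = F i j) ->
  exists X : Y, forall i j, fiber X i j = F i j.
Proof.
move=> F_sym; have [|X XF] := @sliceP R L p (fun l => \matrix_(i, j) F i j l 0).
  by move=> l; apply/matrixP => i j; rewrite !mxE F_sym.
by exists X => i j; apply/matrixP => l k; rewrite !mxE XF mxE ord1.
Qed.

Lemma dotY_fiber X Z :
  dotY X Z = \sum_i \sum_j dotv (fiber X i j) (fiber Z i j).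
Proof.
rewrite dotYE exchange_big [RHS]exchange_big; apply: eq_bigr => i _ /=.
rewrite exchange_big; apply: eq_bigr => j _ /=.
by apply: eq_bigr => l _; rewrite !mxE.
Qed.

Lemma fused_glasso_fiber T : fused_glasso lam1 lam2 T =
  \sum_i \sum_(j | i != j) fused_lasso lam1 lam2 (fiber T i j).
Proof.
rewrite /fused_glasso /fused_lasso.
under [RHS]eq_bigr do rewrite big_split /= -!mulr_sumr.
rewrite big_split /= -!mulr_sumr; congr (_ * _ + _ * _).
  rewrite exchange_big; apply: eq_bigr => i _ /=.
  rewrite exchange_big; apply: eq_bigr => j _ /=.
  by apply: eq_bigr => l _; rewrite mxE.
under [RHS]eq_bigr do under eq_bigr do rewrite norm1_Bmx.
under [RHS]eq_bigr do rewrite exchange_big /=.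
rewrite [RHS]exchange_big; apply: eq_bigr => k _ /=.
under [RHS]eq_bigr do rewrite exchange_big /=.
rewrite [RHS]exchange_big; apply: eq_bigr => l _ /=.
by apply: eq_bigr => i _; apply: eq_bigr => j _; rewrite !mxE.
Qed.

(** Objective and inner product are sums over fibers, so the subgradient inequality for the
    fiberwise candidate is a sum of inequalities; diagonal fibers carry no penalty and stay put. *)
Lemma fiber_prox_glasso X i j : fiber (prox_glasso lam1 lam2 X) i j =
  if i == j then fiber X i j else soft lam1 (x_fused lam2 (fiber X i j)).
Proof.
have [S SE] : exists S : Y, forall i j, fiber S i j =
    if i == j then fiber X i j else soft lam1 (x_fused lam2 (fiber X i j)).
  by apply: fiber_onto => k l; rewrite eq_sym fiber_sym.
suff -> : prox_glasso lam1 lam2 X = S by exact: SE.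
apply: prox_subgradient.
- exact: dotYC.
- by move=> U V W; rewrite -scaleN1r dotYDl dotYZl mulN1r.
- exact: dotY_ge0.
- exact: dotY_eq0.
move=> T; rewrite !fused_glasso_fiber dotY_fiber -big_split.
apply: ler_sum => k _; rewrite !(big_mkcond (fun l => k != l)) -big_split.
apply: ler_sum => l _ /=; rewrite !fiberB.
case: (eqVneq k l) (SE k l) => [->|_] ->.
  by rewrite subrr dotvC dotv0l addr0.
rewrite x_fusedE//; apply: fused_lasso_subgradient => //; exact: z_fused_kkt.
Qed.

Lemma fiber_continuous i j : continuous (fun X => fiber X i j).
Proof.
move=> X; apply: (@cvg_mx_coord _ _ _ _ (nbhs X)) => l k.
apply/(@cvgrPdist_lt _ _ _ (nbhs X)) => e e0.
have near_X : \forall Z \near X, `|X - Z| < e.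
  by have := nbhsx_ballx X e e0; rewrite -ball_normE.
apply: filterS near_X => Z; apply: le_lt_trans.
have -> : fiber X i j l k - fiber Z i j l k = fiber (X - Z) i j l 0.
  by rewrite fiberB !mxE.
rewrite -[leRHS]/(normY (X - Z)) /normY -sqrtr_sqr ler_wsqrtr// dotY_fiber.
rewrite (le_trans (dotv_coord _ l))// (bigD1 i)//= (bigD1 j)//= -addrA lerDl.
apply: addr_ge0; apply: sumr_ge0 => ? _; first exact: dotv_ge0.
by apply: sumr_ge0 => ? _; exact: dotv_ge0.
Qed.

Lemma near_fibers X (P : 'I_p -> 'I_p -> 'cV[R]_L -> Prop) :
  (forall i j, \forall w \near fiber X i j, P i j w) ->
  \forall Z \near X, forall i j, P i j (fiber Z i j).
Proof.
move=> XP; apply: (@filter_forall _ _ _ (nbhs X)) => i.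
apply: (@filter_forall _ _ _ (nbhs X)) => j.
exact: fiber_continuous (XP i j).
Qed.

(** * Operators acting fiber by fiber *)

Lemma symop_fiberwise (M : 'I_p -> 'I_p -> 'M[R]_L) :
  (forall i j, M j i = M i j) ->
  exists W : symop R L p, forall Z i j, fiber (W Z) i j = M i j *m fiber Z i j.
Proof.
move=> M_sym.
have /choice[f fE] Z :
    exists X : Y, forall i j, fiber X i j = M i j *m fiber Z i j.
  by apply: fiber_onto => i j; rewrite M_sym fiber_sym.
have f_linear : linear f.
  move=> a X Z; apply: fiber_ext => i j.
  by rewrite fiberD fiberZ !fE fiberD fiberZ mulmxDr -scalemxAr.
pose fl : {linear Y -> Y} :=
  HB.pack f (GRing.isLinear.Build R Y Y _ f f_linear).
by exists (linfun fl) => Z i j; rewrite lfunE /= fE.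
Qed.

Lemma symop_fiber_ext (W W' : symop R L p) :
  (forall Z i j, fiber (W Z) i j = fiber (W' Z) i j) -> W = W'.
Proof. by move=> WW'; apply/lfunP => Z; exact: fiber_ext. Qed.

(** Extends the family given for i < j to one symmetric in (i, j), so that the three cases of
    [dprox_glasso] become one formula. *)
Definition fiber_op (M : 'I_p -> 'I_p -> 'M[R]_L) i j : 'M[R]_L :=
  if (i < j)%N then M i j else if (j < i)%N then M j i else 1%:M.

Lemma fiber_op_mul M i j (x : 'cV[R]_L) : fiber_op M i j *m x =
  if (i < j)%N then M i j *m x else if (j < i)%N then M j i *m x else x.
Proof. by rewrite /fiber_op; do 2?[case: ifP => _]; rewrite ?mul1mx. Qed.

Lemma fiber_op_sym M i j : fiber_op M j i = fiber_op M i j.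
Proof. by rewrite /fiber_op; case: ltngtP. Qed.

Lemma dprox_glassoP X (W : symop R L p) : dprox_glasso lam1 lam2 X W <->
  exists M,
    (forall i j, (i < j)%N -> dprox_phi lam1 lam2 (fiber X i j) (M i j)) /\
    forall Z i j, fiber (W Z) i j = fiber_op M i j *m fiber Z i j.
Proof.
by split=> -[M [MP WM]]; exists M; split=> // Z i j; rewrite WM fiber_op_mul.
Qed.

Lemma fiber_op_psd X M :
  (forall i j, (i < j)%N -> dprox_phi lam1 lam2 (fiber X i j) (M i j)) ->
  forall i j, psdmx (fiber_op M i j).
Proof.
move=> MP i j; rewrite /fiber_op; case: ltnP => [/MP[]//|_].
case: ltnP => [/MP[]//|_]; split; first exact: trmx1.
by move=> x; rewrite mul1mx dotv_ge0.
Qed.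

Lemma dprox_glasso_nonempty X : dprox_glasso lam1 lam2 X !=set0.
Proof.
have /choice[M MP] ij : exists M, dprox_phi lam1 lam2 (fiber X ij.1 ij.2) M.
  exact: dprox_phi_nonempty.
have [W WM] := symop_fiberwise (fiber_op_sym (fun i j => M (i, j))).
exists W; apply/dprox_glassoP; exists (fun i j => M (i, j)); split=> // i j _.
exact: (MP (i, j)).
Qed.

(** Each pair i < j contributes a pattern and an index set, and these finitely many codes determine
    the operator. *)
Lemma dprox_glasso_finite X : finite_set (dprox_glasso lam1 lam2 X).
Proof.
pose code := ({ffun 'I_L -> bool} * {set 'I_L.-1})%type.
pose Mof (c : code) : 'M[R]_L :=
  diag_mx (\row_i (c.1 i)%:R) *m fused_proj R c.2.
(* At most one operator satisfies this, by [symop_fiber_ext], so [xget] recovers it from its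
   code. *)
pose ops (c : {ffun 'I_p * 'I_p -> code}) : set (symop R L p) :=
  [set W | forall Z i j,
    fiber (W Z) i j = fiber_op (fun i j => Mof (c (i, j))) i j *m fiber Z i j].
apply: (@sub_finite_set _ _ ((fun c => xget 0 (ops c)) @` setT)); last first.
  exact: finite_image finite_finset.
move=> W /dprox_glassoP[M [MP WM]].
(* Pairs without i < j receive an arbitrary code, which [fiber_op] never reads. *)
have /choice[c cP] (ij : 'I_p * 'I_p) :
    exists c, (ij.1 < ij.2)%N -> M ij.1 ij.2 = Mof c.
  have [lt_ij|_] := boolP (ij.1 < ij.2)%N; last first.
    by exists ([ffun=> true], finset.set0).
  have /(dprox_phiP _ lam1_ge0)[_ [d [K [_ _ ->]]]] := MP _ _ lt_ij.
  exists ([ffun i => d i], K) => _; congr (diag_mx _ *m _).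
  by apply/rowP => i; rewrite !mxE ffunE.
exists [ffun ij => c ij] => //; apply: xget_unique => [Z i j|W' W'P].
  rewrite WM; congr (_ *m _); rewrite /fiber_op /= !ffunE.
  by do 2?[case: ifP => [lt_ij|_]; first exact: (cP (_, _))].
apply: symop_fiber_ext => Z i j; rewrite W'P WM; congr (_ *m _).
rewrite /fiber_op /= !ffunE.
by do 2?[case: ifP => [lt_ij|_]; first by rewrite (cP (_, _))].
Qed.

Lemma dprox_glasso_near X : \forall Z \near X, forall W,
  dprox_glasso lam1 lam2 Z W -> dprox_glasso lam1 lam2 X W /\
  prox_glasso lam1 lam2 Z - prox_glasso lam1 lam2 X - W (Z - X) = 0.
Proof.
have := near_fibers (fun i j => dprox_phi_near lam1_ge0 lam2_ge0 (fiber X i j)).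
apply: filterS => Z ZX W /dprox_glassoP[M [MP WM]]; split.
  by apply/dprox_glassoP; exists M; split=> // i j /MP /ZX[].
apply/eqP; rewrite subr_eq0; apply/eqP/fiber_ext => i j.
rewrite WM !fiberB !fiber_prox_glasso /fiber_op -val_eqE.
case: ltngtP => [/MP /ZX[_ ->]//|/MP /ZX[_]|_]; last by rewrite mul1mx.
by rewrite !(fiber_sym _ i j).
Qed.

End Glasso.

Theorem theorem2p1 (R : realType) (p L : nat) (lam1 lam2 : R)
    (hp : (1 <= p)%N) (hL : (2 <= L)%N) (hlam1 : 0 <= lam1) (hlam2 : 0 <= lam2) :
  [/\ (forall X : symfam R L p,
         dprox_glasso lam1 lam2 X !=set0 /\ compact (dprox_glasso lam1 lam2 X))
      /\ upper_semicontinuous (@dprox_glasso R L p lam1 lam2),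
      forall (X : symfam R L p) (W : symop R L p), dprox_glasso lam1 lam2 X W ->
        (forall Y Z : symfam R L p,
           dotY (W Y) Z = dotY Y (W Z)) /\
        (forall Y : symfam R L p, 0 <= dotY Y (W Y))
    & forall X : symfam R L p, \forall Y \near X,
        forall W : symop R L p, dprox_glasso lam1 lam2 Y W ->
          prox_glasso lam1 lam2 Y - prox_glasso lam1 lam2 X
          - W (Y - X) = 0].
Proof.
split; first split.
- move=> X; split; first exact: dprox_glasso_nonempty.
  exact: finite_compact (dprox_glasso_finite _ _ _).
(* Near X the values are contained in the value at X, hence in any V containing it. *)
- move=> X V _ XV; apply: filterS (dprox_glasso_near hlam1 hlam2 X) => Z ZX W.
  by move=> /ZX[/XV].
- move=> X W /dprox_glassoP[M [/fiber_op_psd M_psd WM]]; split=> [Y Z|Y].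
    rewrite !dotY_fiber; apply: eq_bigr => i _; apply: eq_bigr => j _.
    by rewrite !WM dotv_mul; have [-> _] := M_psd i j.
  rewrite dotY_fiber; apply: sumr_ge0 => i _; apply: sumr_ge0 => j _.
  by rewrite WM; have [_ ->] := M_psd i j.
- by move=> X; apply: filterS (dprox_glasso_near hlam1 hlam2 X) => Z ZX W /ZX[].
Qed.
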